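(* Let $K/F$ be a Galois extension of number fields such that $\rho: \operatorname{Gal}(K/F) \rightarrow \operatorname{SL}_n(\mathbb{F}_l)$ is an isomorphism for some rational prime $l$ and positive integer $n$. Let $\mathfrak{p}$ be a prime of $F$ which is unramified in $K$ and $\mathfrak{P}$ a prime of $K$ above $\mathfrak{p}$, with corresponding residue fields $\mathcal{F}$ and $\mathcal{K}$. Write $G=\operatorname{Gal}(K/F)$ and $\overline{G}=\operatorname{Gal}(\mathcal{K}/\mathcal{F})$, where $\overline{G}$ is identified with the decomposition subgroup of $G$ at $\mathfrak{P}$, and let $\operatorname{Frob}_{\mathfrak{p}}\in G$ be the Frobenius element at $\mathfrak{P}$. Let $V, \overline{V}$ be two $\mathbb{F}_l$-vector spaces of dimension $n$. Suppose $V$ (respectively $\overline{V}$) has a faithful $\mathbb{F}_l$-linear action of $G$ (respectively $\overline{G}$), the action of $G$ on $V$ being the one given by $\rho$ (that is, with respect to some ordered basis of $V$ each $g\in G$ acts by the matrix $\rho(g)$), and suppose there exists an $\mathbb{F}_l$-linear isomorphism $\theta: V \rightarrow \overline{V}$ such that $\theta \overline{g} = \overline{g} \theta$ for all $\overline{g} \in \overline{G}$. Suppose furthermore that there are nonzero alternating multilinear forms $T_F \in \Lambda^n V^*$ and $T_{\mathcal{F}} \in \Lambda^n\overline{V}^*$, regarded as maps $T_F: V^n\to\mu_l(F)$ and $T_{\mathcal{F}}:\overline{V}^n\to\mu_l(\mathcal{F})$, such that $$T_F(v_1,\dots,v_n) \bmod \mathfrak{p} \;=\; T_{\mathcal{F}}(\theta(v_1),\dots,\theta(v_n))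 \qquad \text{for all } (v_1,\dots,v_n)\in V^n.$$ Suppose the $\operatorname{GL}_n(\mathbb{F}_l)$-conjugacy class of $\rho(\operatorname{Frob}_{\mathfrak{p}})$ splits into $m$ classes in $\operatorname{SL}_n(\mathbb{F}_l)$, and let $H \subset \mathbb{F}_l^{\times}$ be the unique subgroup such that $[\mathbb{F}_l^{\times}:H]=m$. Suppose $\sigma \in \operatorname{SL}_n(\mathbb{F}_l)$ is $\operatorname{GL}_n(\mathbb{F}_l)$-conjugate to $\rho(\operatorname{Frob}_{\mathfrak{p}})$ and let $\overline{B}$ be an ordered basis of $\overline{V}$ such that the Frobenius automorphism (the Frobenius generator of $\overline{G}$) acts as $\sigma$ on $\overline{V}$ with respect to $\overline{B}$. Let $B$ be an ordered basis of $V$. Then $\rho(\operatorname{Frob}_{\mathfrak{p}})$, written with respect to $B$ (that is, the matrix of the action of $\operatorname{Frob}_{\mathfrak{p}}$ on $V$ with respect to $B$), is $\operatorname{SL}_n(\mathbb{F}_l)$-conjugate to $\sigma$ if and only if $$T_F(B) \bmod \mathfrak{p} \;=\; T_{\mathcal{F}}(\overline{B})^h \qquad \text{for some } h \in H.$$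
   Context: For a field $L$, $\mu_l(L)$ denotes the group of $l$-th roots of unity in $L$. For an $n$-dimensional $\mathbb{F}_l$-vector space $V$, $\Lambda^n V^*$ is the one-dimensional space of alternating multilinear forms $V^n\to\mathbb{F}_l$. The target $\mathbb{F}_l$ (as additive group) is identified with the group of $l$-th roots of unity $\mu_l(F)$, respectively $\mu_l(\mathcal{F})$; in particular these groups have order $l$, and the forms are written multiplicatively. Thus a nonzero form $T$ satisfies: $T(v_1,\dots,v_n)=1$ if and only if $v_1,\dots,v_n$ are linearly dependent, and $T(Av_1,\dots,Av_n)=T(v_1,\dots,v_n)^{\det A}$ for all $A\in\operatorname{GL}_n(\mathbb{F}_l)$. For an ordered basis $B=(b_1,\dots,b_n)$, $T(B)$ means $T(b_1,\dots,b_n)$. Raising an $l$-th root of unity to a power $h\in\mathbb{F}_l^\times$ means raising it to any integer representing $h$. The map $\mu_l(F)\to\mu_l(\mathcal{F})$, $x\mapsto x\bmod\mathfrak{p}$, is reduction modulo $\mathfrak{p}$. Matrices of linear maps with respect to ordered bases of $V$ and $\overline{V}$ are taken with the same convention (e.g. columns are the coordinates of the images of the basis vectors). A $\operatorname{GL}_n(\mathbb{F}_l)$-conjugacy class contained in $\operatorname{SL}_n(\mathbb{F}_l)$ splits into $m$ classes in $\operatorname{SL}_n(\mathbb{F}_l)$ if it is the disjoint union of exactly $m$ conjugacy classes of $\operatorname{SL}_n(\mathbb{F}_l)$. *)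

(* Defs.v *)
From HB Require Import structures.
From mathcomp Require Import all_boot all_order all_fingroup all_algebra.
From mathcomp Require Import all_solvable all_field.
From mathcomp Require Import boolp.

Set Implicit Arguments.
Unset Strict Implicit.
Unset Printing Implicit Defensive.

Import GRing.Theory.
Local Open Scope ring_scope.

(* The law of the group gal_of E is (g * h) x = h (g x).  Accordingly, groups
   act on vector spaces with g * h acting as g followed by h, and the rows of
   the matrix of an endomorphism are the coordinates of the images of the basis
   vectors.  Transposing all matrices and reading the group law as composition
   recovers the convention of left actions and column coordinates. *)

Section RingOfIntegers.
Variable L : fieldType.

Definition int_closure : {pred L} := fun x => `[< integralOver (intr : int -> L) x >].

Lemma int_closure_subring : subring_closed int_closure.
Proof.
split; first exact/asboolP/integral1.
- by move=> x y /asboolP intx /asboolP inty; apply/asboolP/integral_sub.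
- by move=> x y /asboolP intx /asboolP inty; apply/asboolP/integral_mul.
Qed.

HB.instance Definition _ :=
  GRing.isSubringClosed.Build L int_closure int_closure_subring.

Record ringInt := RingInt {ringInt_val : L; _ : ringInt_val \in int_closure}.

HB.instance Definition _ := [isSub for ringInt_val].
HB.instance Definition _ := [Choice of ringInt by <:].
HB.instance Definition _ := [SubChoice_isSubComNzRing of ringInt by <:].

End RingOfIntegers.

Arguments int_closure L : clear implicits.

Lemma int_closure_morph (L M : fieldType) (f : {rmorphism L -> M}) (x : L) :
  x \in int_closure L -> f x \in int_closure M.
Proof.
move=> /asboolP [p pm px]; apply/asboolP; exists p => //.
suff -> : map_poly (intr : int -> M) p = map_poly f (map_poly intr p).
  exact: rmorph_root.
by rewrite -map_poly_comp; apply: eq_map_poly => m /=; rewrite rmorph_int.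
Qed.

Definition ringInt_map (L M : fieldType) (f : {rmorphism L -> M})
    (x : ringInt L) : ringInt M :=
  RingInt (int_closure_morph f (valP x)).

Section Primes.
Variables (F : fieldExtType rat) (K : splittingFieldType F).

Definition prime_of (L : fieldType) (I : {pred ringInt L}) : Prop :=
  [/\ idealr_closed I, prime_idealr_closed I & exists2 x, x \in I & x != 0].

Definition OF_to_OK : ringInt F -> ringInt K := ringInt_map (in_alg K).

Definition lies_above (P : {pred ringInt K}) (p : {pred ringInt F}) : Prop :=
  forall x, (OF_to_OK x \in P) = (x \in p).

Definition ideal_mul (R : comNzRingType) (I J : R -> Prop) : R -> Prop :=
  fun z => exists s : seq (R * R),
    (forall u, u \in s -> I u.1 /\ J u.2) /\ z = \sum_(u <- s) u.1 * u.2.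

Definition ideal_exp (R : comNzRingType) (I : R -> Prop) (e : nat) : R -> Prop :=
  iter e (ideal_mul I) (fun=> True).

Definition ideal_ext (p : {pred ringInt F}) : ringInt K -> Prop :=
  ideal_mul (fun y => exists2 x, x \in p & y = OF_to_OK x) (fun=> True).

Definition ramification_index (p : {pred ringInt F}) (P : {pred ringInt K})
    (e : nat) : Prop :=
  (forall x, ideal_ext p x -> ideal_exp (fun y => y \in P) e x) /\
  ~ (forall x, ideal_ext p x -> ideal_exp (fun y => y \in P) e.+1 x).

(* Residue fields of number fields are finite, so that separability of the
   residue extensions is automatic. *)
Definition unramified (p : {pred ringInt F}) : Prop :=
  forall P, prime_of P -> lies_above P p -> ramification_index p P 1.

(* A residue field of I is a field k together with a surjection from the ring
   of integers onto k with kernel I. *)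
Definition residue_map (L k : fieldType) (I : {pred ringInt L})
    (red : {rmorphism ringInt L -> k}) : Prop :=
  (forall y, exists x, red x = y) /\ (forall x, (red x == 0) = (x \in I)).

Definition gal_int (g : gal_of {:K}) : ringInt K -> ringInt K := ringInt_map g.

Definition decomposition (P : {pred ringInt K}) : {set gal_of {:K}} :=
  [set g in 'Gal({:K} / 1)%g | `[< forall x, (gal_int g x \in P) = (x \in P) >]].

Definition is_Frobenius (P : {pred ringInt K}) (q : nat) (g : gal_of {:K}) : Prop :=
  g \in decomposition P /\ forall x, gal_int g x - x ^+ q \in P.

(* The graph of the canonical map from the decomposition group of P to the
   Galois group of the residue extension, an isomorphism when P is unramified. *)
Definition induces (kF : finFieldType) (kK : splittingFieldType kF)
    (P : {pred ringInt K}) (redK : {rmorphism ringInt K -> kK})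
    (g : gal_of {:K}) (gbar : gal_of {:kK}) : Prop :=
  [/\ g \in decomposition P, gbar \in 'Gal({:kK} / 1)%g
    & forall x, gbar (redK x) = redK (gal_int g x)].

End Primes.

Definition mu (l : nat) (L : fieldType) := {x : L | x ^+ l == 1}.

Lemma mu_int (l : nat) (L : fieldType) (x : mu l L) :
  (0 < l)%N -> val x \in int_closure L.
Proof.
move=> l_gt0; apply/asboolP; exists ('X^l - 1).
  by rewrite monicXnsubC.
rewrite rmorphB /= map_polyXn rmorph1 /root !hornerE.
by rewrite (eqP (valP x)) subrr.
Qed.

(* The default 0 in insubd is irrelevant for l > 0, by mu_int. *)
Definition mu_mod (l : nat) (L k : fieldType) (red : {rmorphism ringInt L -> k})
    (x : mu l L) : k :=
  red (insubd 0 (val x)).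

Section Forms.
Variables (l n : nat) (V : vectType 'F_l).

Definition set_tnth (v : n.-tuple V) (i : 'I_n) (x : V) : n.-tuple V :=
  [tuple if j == i then x else tnth v j | j < n].

Definition multilinear (t : n.-tuple V -> 'F_l) : Prop :=
  forall v i a x y,
    t (set_tnth v i (a *: x + y)) = a * t (set_tnth v i x) + t (set_tnth v i y).

Definition alternating (t : n.-tuple V -> 'F_l) : Prop :=
  forall v i j, i != j -> tnth v i = tnth v j -> t v = 0.

(* T is a nonzero alternating multilinear form once F_l is identified with
   mu_l(L) through a |-> z ^+ a for some primitive l-th root of unity z. *)
Definition nonzero_mu_form (L : fieldType) (T : n.-tuple V -> mu l L) : Prop :=
  exists (z : L) (t : n.-tuple V -> 'F_l),
    [/\ l.-primitive_root z, multilinear t, alternating t, exists v, t v != 0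
      & forall v, val (T v) = z ^+ t v].

Definition mx_in (B : n.-tuple V) (f : 'End(V)) : 'M['F_l]_n :=
  \matrix_(i, j) coord B j (f (tnth B i)).

Definition linear_action (gT : finGroupType) (G : {group gT})
    (a : gT -> 'End(V)) : Prop :=
  a 1%g = \1%VF /\ {in G &, forall g h, a (g * h)%g = (a h \o a g)%VF}.

Definition faithful_action (gT : finGroupType) (G : {group gT})
    (a : gT -> 'End(V)) : Prop :=
  forall g, g \in G -> (forall v, a g v = v) -> g = 1%g.

End Forms.

Section SpecialLinear.
Variables (n l : nat).

Definition SLset : {set {'GL_n.+1['F_l]}} :=
  [set u : {'GL_n.+1['F_l]} | \det (GLval u) == 1].

Lemma SL_group_set : group_set SLset.
Proof.
apply/group_setP; split=> [|u v]; rewrite !inE ?GL_1E ?det1 //.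
by rewrite GL_ME det_mulmx => /eqP-> /eqP->; rewrite mul1r.
Qed.

Canonical SL : {group {'GL_n.+1['F_l]}} := Group SL_group_set.

Definition splits_in_SL (u : {'GL_n.+1['F_l]}) (m : nat) : Prop :=
  exists P : {set {set {'GL_n.+1['F_l]}}},
    [/\ P \subset classes SL, partition P (u ^: 'GL_n.+1['F_l])%g & #|P| = m].

End SpecialLinear.

(* Main.v *)
Require Import Defs.
From HB Require Import structures.
From mathcomp Require Import all_boot all_order all_fingroup all_algebra.
From mathcomp Require Import all_solvable all_field.
From mathcomp Require Import ring.

(** Both sides are transported to [Vbar] through [theta].  If [a] is the matrix
    expressing [theta B] in [Bbar], then the matrix of Frobenius with respect to
    [B] is [a *m sigma *m a^-1], which is SL-conjugate to [sigma] iff [det a] lies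
    in [det C(sigma)], while [TkF (theta B) = TkF Bbar ^ det a].  Finally
    [det C(sigma)] is [H]: comparing class sizes in GL and in SL shows that its
    index is [m], and the group of units of a finite field is cyclic. *)

Set Implicit Arguments.
Unset Strict Implicit.
Unset Printing Implicit Defensive.

Import GRing.Theory.
Local Open Scope ring_scope.

(** * Splitting of a conjugacy class over the kernel of a morphism *)

Section ClassSplitting.
Local Open Scope group_scope.
Variables (aT rT : finGroupType) (G : {group aT}) (f : {morphism G >-> rT}).

(** The parts are classes under the kernel, and normality of the kernel gives them all the size
    [#|'ker f : 'C_('ker f)[x]|]. The whole class has size [#|G : 'C_G[x]|], which factors as the
    index of the images under [f] times the index inside the kernel; cancelling the latter leaves
    [#|P|]. *)
Lemma card_split_class x (P : {set {set aT}}) :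
    x \in G -> P \subset classes ('ker f) -> partition P (x ^: G) ->
  #|P| = #|f @* G : f @* 'C_G[x]|.
Proof.
move=> Gx sPS partP.
have cardA A : A \in P -> #|A| = #|'ker f : 'C_('ker f)[x]|.
  move=> PA; have /imsetP[y Sy defA] := subsetP sPS _ PA.
  have: y \in x ^: G.
    rewrite -(cover_partition partP); apply/bigcupP; exists A => //.
    by rewrite defA class_refl.
  case/imsetP=> g Gg defy.
  rewrite defA -index_cent1 defy cent1J.
  have kerJ: 'ker f :^ g = 'ker f by apply: (normsP (ker_norm f)).
  by rewrite /= -[in LHS]kerJ -conjIg indexJg.
have := card_uniform_partition cardA partP.
rewrite -index_cent1 -(index_morphim_ker f (subsetIl G 'C[x]) (subxx G)).
have kerI : 'ker_G f = 'ker f by apply/setIidPr/subsetIl.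
rewrite kerI -(indexgI _ 'C_G[x]) /= setIA [_ :&: G]setIC kerI.
by move/eqP; rewrite eqn_pmul2r ?indexg_gt0 // => /eqP.
Qed.

(** [x ^ a = x ^ s] means that [a * s^-1] centralizes [x]. So the conjugates in question come from
    products of a centralizing element and a kernel element, and [f] detects such products. *)
Lemma conjg_in_class_ker x a :
  a \in G -> (x ^ a \in x ^: 'ker f) = (f a \in f @* 'C_G[x]).
Proof.
move=> Ga; apply/imsetP/morphimP=> [[s Ks xas] | [c Gc /setIP[_ Cc] fac]].
  have Gs: s \in G by apply: subsetP Ks; apply: subsetIl.
  have Gas : a * s^-1 \in G by rewrite groupM ?groupV.
  exists (a * s^-1) => //.
    apply/setIP; split=> //.
    by apply/cent1P/commute_sym/commgP/conjg_fixP; rewrite conjgM xas conjgK.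
  by rewrite morphM ?groupV // morphV // (mker Ks) invg1 mulg1.
exists (c^-1 * a).
  by apply/kerP; rewrite ?groupM ?groupV // morphM ?groupV // morphV // fac mulVg.
by rewrite conjgM; congr (_ ^ _); apply/esym/conjg_fixP/commgP/commuteV/commute_sym/cent1P.
Qed.

End ClassSplitting.

(** * The determinant as a morphism onto the group of units *)

Section GLDet.
Local Open Scope group_scope.
Variables (n : nat) (R : finFieldType).

(** Taking values in the finite group [{unit R}] rather than in [R] makes the determinant a morphism
    to which the class-splitting lemmas apply. *)
Definition GL_det_unit (u : {'GL_n.+1[R]}) : {unit R} :=
  FinRing.Unit (etrans (unitfE _) (GL_det u)).

Lemma GL_det_unitM : {in setT &, {morph GL_det_unit : u v / u * v}}.
Proof. by move=> u v _ _; apply: val_inj; apply: det_mulmx. Qed.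

Canonical GL_det_morphism := Morphism GL_det_unitM.

(** The matrix [diag(c, 1, ..., 1)] is a preimage of [c]. This makes the index in [card_split_class]
    an index in the full unit group. *)
Lemma GL_det_unit_surj : GL_det_unit @* [set: {'GL_n.+1[R]}] = setT.
Proof.
apply/setP=> c; rewrite inE; apply/morphimP.
pose d : 'rV[R]_n.+1 := \row_i if i == ord0 then val c else 1%R.
have det_d : \det (diag_mx d) = val c.
  rewrite det_diag (bigD1 ord0) //= mxE eqxx big1 ?GRing.mulr1 // => i.
  by rewrite mxE => /negPf->.
have Ud : diag_mx d \is a GRing.unit 
    by change (diag_mx d \in unitmx); rewrite unitmxE det_d (valP c).
exists (FinRing.Unit Ud : {'GL_n.+1[R]}); rewrite ?inE //.
by apply: val_inj; rewrite /= det_d.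
Qed.

End GLDet.

Lemma ker_GL_det_unit n l : ('ker (@GL_det_unit n 'F_l))%g = SL n l :> {set _}.
Proof.
apply/setP=> u; rewrite !inE; apply/eqP/eqP=> [/(congr1 val) //|det1].
exact: val_inj.
Qed.

(** * Alternating multilinear forms and determinants of coordinates *)

Section AlternatingForms.
Variables (l n : nat) (V : vectType 'F_l).
Implicit Types (v E B : n.-tuple V) (t : n.-tuple V -> 'F_l).

Lemma tnth_set_tnth v i x j :
  tnth (set_tnth v i x) j = if j == i then x else tnth v j.
Proof. exact: tnth_mktuple. Qed.

Lemma set_tnth_id v i : set_tnth v i (tnth v i) = v.
Proof. by apply: eq_from_tnth => j; rewrite tnth_set_tnth; case: eqP => // ->. Qed.

Lemma set_tnthC v i j x y : i != j ->
  set_tnth (set_tnth v i x) j y = set_tnth (set_tnth v j y) i x.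
Proof.
move=> ij; apply: eq_from_tnth => k; rewrite !tnth_set_tnth.
by case: eqP => // ->; rewrite eq_sym (negPf ij).
Qed.

Lemma multilinearD t v i x y : multilinear t ->
  t (set_tnth v i (x + y)) = t (set_tnth v i x) + t (set_tnth v i y).
Proof. by move=> tlin; have := tlin v i 1 x y; rewrite scale1r mul1r. Qed.

Lemma multilinear_sum t v i (I : finType) (a : I -> 'F_l) (x : I -> V) :
    multilinear t ->
  t (set_tnth v i (\sum_k a k *: x k)) = \sum_k a k * t (set_tnth v i (x k)).
Proof.
move=> tlin; have t0 : t (set_tnth v i 0) = 0.
  have := multilinearD v i 0 0 tlin; rewrite addr0.
  by move/esym/(canRL (addrK _)); rewrite subrr.
elim/big_rec2: _ => // k s1 s2 _ <-; exact: tlin.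
Qed.

(** Polarization: [t] vanishes when the sum of the two entries stands in both positions. In its
    expansion the two terms with a repeated entry vanish, so the other two are opposite. *)
Lemma alternating_swap t v i j : multilinear t -> alternating t -> i != j ->
  t [tuple tnth v (tperm i j k) | k < n] = - t v.
Proof.
move=> tlin talt ij; set w := mktuple _.
pose r x y := set_tnth (set_tnth v i x) j y.
have r0 x : t (r x x) = 0.
  by apply: (talt _ i j) => //; rewrite !tnth_set_tnth eqxx (negPf ij) eqxx.
have rDl x y z : t (r (x + y) z) = t (r x z) + t (r y z).
  by rewrite /r !(set_tnthC _ _ _ ij) multilinearD.
have rDr x y z : t (r z (x + y)) = t (r z x) + t (r z y).
  by rewrite /r multilinearD.
have -> : v = r (tnth v i) (tnth v j).
  by rewrite /r !set_tnth_id.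
have -> : w = r (tnth v j) (tnth v i).
  apply: eq_from_tnth => k; rewrite /w tnth_mktuple !tnth_set_tnth.
  case: tpermP => [->|->|/eqP/negPf-> /eqP/negPf->] //; last by rewrite eqxx.
  by rewrite (negPf ij) eqxx.
have := r0 (tnth v i + tnth v j).
by rewrite rDl !rDr !r0 add0r addr0 addrC => /eqP; rewrite addr_eq0 => /eqP.
Qed.

(** Each transposition in a factorization of [s] only changes the sign. Stating just the vanishing
    avoids tracking the signature. *)
Lemma alternating_perm_eq0 t v (s : 'S_n) : multilinear t -> alternating t ->
  t v = 0 -> t [tuple tnth v (s k) | k < n] = 0.
Proof.
move=> tlin talt; have [ts -> tsP] := prod_tpermP s.
elim: ts v tsP => [|[i j] ts IHts] v /= => [_ | /andP[ij tsP]] tv0.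
  rewrite big_nil -[RHS]tv0; congr (t _).
  by apply: eq_from_tnth => k; rewrite tnth_mktuple perm1.
rewrite big_cons /=; set w := [tuple tnth v ((\prod_(u <- ts) tperm u.1 u.2)%g k) | k < n].
rewrite (_ : mktuple _ = [tuple tnth w (tperm i j k) | k < n]).
  by rewrite alternating_swap // IHts // oppr0.
by apply: eq_from_tnth => k; rewrite !tnth_mktuple permM.
Qed.

(* Induction on the length of an initial segment of [v] outside which all entries
   belong to [E], expanding the last entry of that segment in the basis. *)
Lemma alternating_eq0 t E : basis_of {:V} E -> multilinear t -> alternating t ->
  t E = 0 -> forall v, t v = 0.
Proof.
move=> Ebasis tlin talt tE0.
suff H k v : (forall i : 'I_n, (k <= i)%N -> exists j, tnth v i = tnth E j) -> t v = 0.
  by move=> v; apply: (H n) => i; rewrite leqNgt ltn_ord.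
elim: k v => [|k IHk] v vE.
  have /fin_all_exists[f fE] i := vE i (leq0n i).
  have [/injectiveP f_inj | /injectivePn[i [j ij fij]]] := boolP (injectiveb f).
    rewrite -(alternating_perm_eq0 (perm f_inj) tlin talt tE0); congr (t _).
    by apply: eq_from_tnth => i; rewrite tnth_mktuple permE.
  by apply: (talt _ i j) => //; rewrite !fE fij.
have [kn | nk] := ltnP k n; last first.
  by apply: IHk => i /(leq_trans nk); rewrite leqNgt ltn_ord.
pose i := Ordinal kn.
rewrite -(set_tnth_id v i) (coord_basis Ebasis (memvf (tnth v i))).
rewrite multilinear_sum // big1 // => j _; rewrite IHk ?mulr0 // => i' le_ki'.
rewrite tnth_set_tnth; case: eqP => [_ | /eqP ne_i'i].
  by exists j; rewrite (tnth_nth 0).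
apply: vE; rewrite ltn_neqAle le_ki' andbT.
by apply: contraNN ne_i'i => /eqP eq_ki'; apply/eqP/val_inj.
Qed.

Definition coords E v : 'M['F_l]_n := \matrix_(i, j) coord E j (tnth v i).

Lemma coords_id E : free E -> coords E E = 1%:M.
Proof.
by move=> Efree; apply/matrixP=> i j; rewrite !mxE (tnth_nth 0) coord_free.
Qed.

Lemma coords_mul E B v : basis_of {:V} B -> coords E v = coords B v *m coords E B.
Proof.
move=> Bbasis; apply/matrixP=> i j; rewrite !mxE.
rewrite {1}(coord_basis Bbasis (memvf (tnth v i))) linear_sum /=.
by apply: eq_bigr => k _; rewrite linearZ !mxE /= (tnth_nth 0 B).
Qed.

Lemma coords_unit E B :
  basis_of {:V} E -> basis_of {:V} B -> coords E B \in unitmx.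
Proof.
move=> Ebasis Bbasis.
have := coords_mul B B Ebasis; rewrite coords_id ?(basis_free Bbasis) //.
by move/esym/mulmx1_unit => [].
Qed.

(** Both sides are the coordinates in [E] of the images under [f] of the vectors of [B]. *)
Lemma mx_in_change_basis E B (f : 'End(V)) :
    basis_of {:V} E -> basis_of {:V} B ->
  mx_in B f *m coords E B = coords E B *m mx_in E f.
Proof.
move=> Ebasis Bbasis.
have mx_inE C : mx_in C f = coords C (map_tuple f C).
  by apply/matrixP=> i j; rewrite !mxE tnth_map.
rewrite !mx_inE -coords_mul //; apply/matrixP=> i j; rewrite !mxE tnth_map.
rewrite {1}(coord_basis Ebasis (memvf (tnth B i))) !linear_sum /=.
by apply: eq_bigr => k _; rewrite !mxE tnth_map !linearZ /= (tnth_nth 0 E).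
Qed.

Lemma det_coords_multilinear E : multilinear (fun v => \det (coords E v)).
Proof.
move=> v i a x y; rewrite -[X in _ = _ + X]mul1r.
apply: (determinant_multilinear (i0 := i)).
- by apply/rowP=> j; rewrite !mxE !tnth_set_tnth eqxx linearP mul1r.
- by apply/matrixP=> k j; rewrite !mxE !tnth_set_tnth eq_sym (negPf (neq_lift _ _)).
- by apply/matrixP=> k j; rewrite !mxE !tnth_set_tnth eq_sym (negPf (neq_lift _ _)).
Qed.

Lemma det_coords_alternating E : alternating (fun v => \det (coords E v)).
Proof.
by move=> v i j ij vij; apply: (determinant_alternate ij) => k; rewrite !mxE vij.
Qed.

(** The difference of the two sides is alternating and multilinear in [v] and vanishes at [E], hence
    everywhere. *)
Lemma alternating_det t E v :
    basis_of {:V} E -> multilinear t -> alternating t ->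
  t v = \det (coords E v) * t E.
Proof.
move=> Ebasis tlin talt; apply/eqP; rewrite -subr_eq0; apply/eqP.
apply: (alternating_eq0 (t := fun v => t v - \det (coords E v) * t E) Ebasis).
- move=> w i a x y; rewrite tlin det_coords_multilinear; ring.
- move=> w i j ij wij.
  by rewrite (talt w i j) // (det_coords_alternating E ij wij) mul0r subr0.
- by rewrite coords_id ?(basis_free Ebasis) // det1 mul1r subrr.
Qed.

End AlternatingForms.

(** * The Frobenius element and its action on the residue field *)

Section Frobenius.
Variables (F : fieldExtType rat) (K : splittingFieldType F).
Variables (kF : finFieldType) (kK : splittingFieldType kF).

(** Since [redK] has kernel [P], the congruence defining the Frobenius element becomes the
    [#|kF|]-th power map on residues. The equivariance of [theta] can then be applied to the pair
    [Frob], [frob]. *)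
Lemma Frobenius_induces (P : {pred ringInt K}) (redK : {rmorphism ringInt K -> kK})
    (Frob : gal_of {:K}) (frob : gal_of {:kK}) :
    residue_map P redK -> is_Frobenius P #|kF| Frob ->
    frob \in 'Gal({:kK} / 1)%g -> (forall x, frob x = x ^+ #|kF|) ->
  induces P redK Frob frob.
Proof.
move=> [_ redK_ker] [decFrob FrobE] Gfrob frobE; split=> // x.
have := FrobE x; rewrite -redK_ker rmorphB subr_eq0 => /eqP->.
by rewrite rmorphXn frobE.
Qed.

End Frobenius.

(** * Transport of bases and matrices along an isomorphism *)

Section Transport.
Variables (l n : nat) (V W : vectType 'F_l) (theta : 'Hom(V, W)).
Hypotheses (theta_bij : bijective theta).

Lemma bij_basis (B : n.-tuple V) :
  basis_of {:V} B -> basis_of {:W} (map_tuple theta B).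
Proof.
move=> Bbasis; have ker0 : lker theta == 0%VS by apply/lker0P/bij_inj.
have <- : limg theta = fullv.
  apply/eqP; rewrite eqEsubv subvf; apply/subvP=> w _.
  have [theta' _ thetaK] := theta_bij.
  by rewrite -[w]thetaK memv_img ?memvf.
by apply: limg_basis_of; rewrite ?(eqP ker0) ?capv0.
Qed.

(** Applying [theta] to the expansion of [f b] in [B], for [b] in [B], gives the expansion of
    [g (theta b)] in the image basis, with the same coefficients. *)
Lemma mx_in_transport (B : n.-tuple V) (f : 'End(V)) (g : 'End(W)) :
    basis_of {:V} B -> (forall v, theta (f v) = g (theta v)) ->
  mx_in B f = mx_in (map_tuple theta B) g.
Proof.
move=> Bbasis fg; apply/matrixP=> i j; rewrite !mxE tnth_map -fg.
have thetaB (k : 'I_n) : theta B`_k = (map_tuple theta B)`_k.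
  by rewrite (nth_map 0) // size_tuple.
rewrite [in RHS](coord_basis Bbasis (memvf (f (tnth B i)))) linear_sum /=.
under eq_bigr do rewrite linearZ /= thetaB.
by rewrite coord_sum_free // (basis_free (bij_basis Bbasis)).
Qed.

End Transport.

(** Powers of [z] depend only on the exponent modulo [l], so a multiplicative relation between roots
    of unity becomes a linear one in ['F_l]. *)
Lemma prim_root_exprFp (l : nat) (L : fieldType) (z : L) (x y : 'F_l) (i : nat) :
    prime l -> l.-primitive_root z ->
  (z ^+ x == (z ^+ y) ^+ i) = (x == y * i%:R).
Proof.
move=> l_prime zprim; rewrite -exprM (eq_prim_root_expr zprim).
by rewrite -!val_Fp_nat // val_eqE natrM !natr_Zp.
Qed.

(** * The conjugacy criterion for the Frobenius element *)

Theorem theorem8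
  (l n : nat) (l_prime : prime l)
  (F : fieldExtType rat) (K : splittingFieldType F)
  (galKF : galois 1 {:K})
  (rho : {morphism 'Gal({:K} / 1)%g >-> {'GL_n.+1['F_l]}})
  (rho_isom : isom 'Gal({:K} / 1)%g (SL n l) rho)
  (p : {pred ringInt F}) (P : {pred ringInt K})
  (p_prime : prime_of p) (p_unram : unramified K p)
  (P_prime : prime_of P) (P_above : lies_above P p)
  (kF : finFieldType) (kK : splittingFieldType kF)
  (redF : {rmorphism ringInt F -> kF}) (redF_res : residue_map p redF)
  (redK : {rmorphism ringInt K -> kK}) (redK_res : residue_map P redK)
  (red_compat : forall x, redK (OF_to_OK K x) = (redF x)%:A)
  (Frob : gal_of {:K}) (Frob_at_P : is_Frobenius P #|kF| Frob)
  (frob : gal_of {:kK}) (frob_in : frob \in 'Gal({:kK} / 1)%g)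
  (frobE : forall x : kK, frob x = x ^+ #|kF|)
  (V Vbar : vectType 'F_l)
  (dimV : \dim {:V} = n.+1) (dimVbar : \dim {:Vbar} = n.+1)
  (act : gal_of {:K} -> 'End(V)) (actbar : gal_of {:kK} -> 'End(Vbar))
  (act_lin : linear_action 'Gal({:K} / 1)%G act)
  (act_faithful : faithful_action 'Gal({:K} / 1)%G act)
  (actbar_lin : linear_action 'Gal({:kK} / 1)%G actbar)
  (actbar_faithful : faithful_action 'Gal({:kK} / 1)%G actbar)
  (act_rho : exists B0 : n.+1.-tuple V, basis_of {:V} B0 /\
     forall g, g \in 'Gal({:K} / 1)%g -> mx_in B0 (act g) = GLval (rho g))
  (theta : 'Hom(V, Vbar)) (theta_bij : bijective theta)
  (theta_equiv : forall g gbar, induces P redK g gbar ->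
     forall v, theta (act g v) = actbar gbar (theta v))
  (TF : n.+1.-tuple V -> mu l F) (TkF : n.+1.-tuple Vbar -> mu l kF)
  (TF_form : nonzero_mu_form TF) (TkF_form : nonzero_mu_form TkF)
  (TF_red : forall v : n.+1.-tuple V,
     mu_mod redF (TF v) = val (TkF (map_tuple theta v)))
  (m : nat) (m_split : splits_in_SL (rho Frob) m)
  (H : {group {unit 'F_l}}) (H_index : #|[set: {unit 'F_l}] : H|%g = m)
  (sigma : {'GL_n.+1['F_l]}) (sigma_SL : sigma \in SL n l)
  (sigma_conj : sigma \in (rho Frob ^: 'GL_n.+1['F_l])%g)
  (Bbar : n.+1.-tuple Vbar) (Bbar_basis : basis_of {:Vbar} Bbar)
  (Bbar_sigma : mx_in Bbar (actbar frob) = GLval sigma)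
  (B : n.+1.-tuple V) (B_basis : basis_of {:V} B) :
  (exists2 tau, tau \in (sigma ^: SL n l)%g & mx_in B (act Frob) = GLval tau)
  <->
  (exists2 h : {unit 'F_l}, h \in H &
     mu_mod redF (TF B) = val (TkF Bbar) ^+ (val h : 'F_l)).
Proof.
have act_frob v : theta (act Frob v) = actbar frob (theta v).
  exact/theta_equiv/Frobenius_induces.
have defB := mx_in_transport theta_bij B_basis act_frob.
pose B' := map_tuple theta B; have B'_basis : basis_of {:Vbar} B' by apply: bij_basis.
have Ua : coords Bbar B' \is a GRing.unit by apply: coords_unit.
pose a : {'GL_n.+1['F_l]} := FinRing.Unit Ua.
(* Since [x ^ y] stands for [y^-1 * x * y], the product of [a], [sigma] and [a^-1] is conjugation by
   [a^-1]. *)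
have mx_Frob : mx_in B (act Frob) = GLval (sigma ^ a^-1)%g.
  rewrite defB conjgE invgK !GL_MxE -Bbar_sigma mulmxA.
  by rewrite -[LHS](mulmxK Ua) mx_in_change_basis.
pose f := GL_det_morphism n 'F_l.
have H_eq : H = (f @* 'C_[set: {'GL_n.+1['F_l]}][sigma])%G.
  have [Q [sQ partQ cardQ]] := m_split.
  (* The splitting hypothesis is about the class of [rho Frob], which is also the class of
     [sigma]. *)
  have sigma_class := class_eqP sigma_conj.
  have idx := card_split_class (f := f) (in_setT sigma).
  have := idx Q; rewrite /= ker_GL_det_unit GL_det_unit_surj sigma_class.
  move/(_ sQ partQ); rewrite cardQ -H_index => idxE.
  (* Equal indices give equal orders by Lagrange, and subgroups of a cyclic group are determined by
     their order. *)
  apply/group_inj/eqP.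
  rewrite (eq_subG_cyclic (field_unit_group_cyclic [set: _]%G)) ?subsetT //.
  have Lagr (J : {group {unit 'F_l}}) := Lagrange (subsetT J).
  have := Lagr H; rewrite -(Lagr (f @* 'C_[set: {'GL_n.+1['F_l]}][sigma])%G) idxE.
  by move/eqP; rewrite eqn_pmul2r ?indexg_gt0.
(* The conjugating element is [a^-1], but a subgroup contains the inverse of [f a] exactly when it
   contains [f a]. *)
have conjE : (sigma ^ a^-1 \in sigma ^: SL n l)%g = (f a \in H).
  rewrite -ker_GL_det_unit (conjg_in_class_ker f) ?inE // H_eq.
  by rewrite morphV ?inE ?groupV.
have [z [t [zprim tlin talt [v tv0] TkFE]]] := TkF_form.
(* Every value of [t] is a multiple of [t Bbar], so a nonzero form cannot vanish on this basis. *)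
have tBbar0 : t Bbar != 0.
  by apply: contraNneq tv0 => tB0; rewrite (alternating_det v Bbar_basis) // tB0 mulr0.
(* The reduction of [TF B] is [TkF B'], whose exponent is [\det a * t Bbar]; cancelling [t Bbar]
   shows that [f a] is the only possible [h]. *)
have TE (h : {unit 'F_l}) :
    (mu_mod redF (TF B) == val (TkF Bbar) ^+ (val h : 'F_l)) = (f a == h).
  rewrite TF_red !TkFE prim_root_exprFp // natr_Zp.
  rewrite (alternating_det B' Bbar_basis) // [t Bbar * _]mulrC.
  by rewrite (inj_eq (mulIf tBbar0)).
split=> [[tau tau_sigma] | [h Hh /eqP]].
  rewrite mx_Frob => eq_tau; have defa : (sigma ^ a^-1)%g = tau by apply: val_inj.
  rewrite -defa conjE in tau_sigma.
  by exists (f a) => //; apply/eqP; rewrite TE.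
rewrite TE => /eqP fa; exists (sigma ^ a^-1)%g => //.
by rewrite conjE fa.
Qed.
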